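(* Let $\mathcal{A}=\{A_i\}_{i=1}^m$ with $A_i\in\mathbb{R}^{n\times n}$. Suppose that the exact general joint block diagonalization problem for $\mathcal{A}$ has a solution $(\tau_n,W)$, where $\tau_n=(n_1,\dots,n_t)$ is a partition of $n$ and $$W^TA_iW=\mathrm{diag}(A_i^{(11)},\dots,A_i^{(tt)}),\quad A_i^{(jj)}\in\mathbb{R}^{n_j\times n_j},\quad i=1,\dots,m.$$ For $j=1,\dots,t$, let $\mathcal{A}_j=\{A_i^{(jj)}\}_{i=1}^m$. The following statements are equivalent: (1) All solutions to the exact general joint block diagonalization problem for $\mathcal{A}$ are equivalent. (2) $\dim\mathscr{N}(\mathcal{A})=\sum_{j=1}^t\dim\mathscr{N}(\mathcal{A}_j)$. (3) For any $1\le j<k\le t$, the matrix $$M_{jk}=\sum_{i=1}^m\begin{bmatrix} I_{n_k}\otimes\big[(A_i^{(jj)})^TA_i^{(jj)}+A_i^{(jj)}(A_i^{(jj)})^T\big] & A_i^{(kk)}\otimes A_i^{(jj)}+(A_i^{(kk)})^T\otimes (A_i^{(jj)})^T\\ A_i^{(kk)}\otimes A_i^{(jj)}+(A_i^{(kk)})^T\otimes (A_i^{(jj)})^T & \big[(A_i^{(kk)})^TA_i^{(kk)}+A_i^{(kk)}(A_i^{(kk)})^T\big]\otimes I_{n_j}\end{bmatrix}$$ is nonsingular.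
   Context: A partition of a positive integer $n$ is a tuple $\tau_n=(n_1,\dots,n_t)$ of positive integers with $\sum_i n_i=n$; its cardinality is $\mathrm{card}(\tau_n)=t$. For such a partition, a matrix of order $n$ is $\tau_n$-block diagonal if it has the form $\mathrm{diag}(A_{11},\dots,A_{tt})$ with $A_{jj}$ of order $n_j$. Exact joint block diagonalization (JBD) problem for $\mathcal{A}$ and $\tau_n$: find a nonsingular $W\in\mathbb{R}^{n\times n}$ such that $W^TA_iW$ is $\tau_n$-block diagonal for all $i=1,\dots,m$. Exact general joint block diagonalization problem for $\mathcal{A}$: find a partition $\tau_n'$ of $n$ and a nonsingular $W$ that solves the JBD problem for $\mathcal{A}$ and $\tau_n'$, such that $\mathrm{card}(\tau_n')$ is the maximum of $\mathrm{card}(\tau_n)$ over all partitions $\tau_n$ of $n$ for which the JBD problem for $\mathcal{A}$ and $\tau_n$ has a solution. Such a pair $(\tau_n',W)$ is called a solution. Equivalence of solutions: $(\tau_n,W)$ with $\tau_n=(n_1,\dots,n_t)$ and $(\hat\tau_n,\widehat W)$ are equivalent if $(\hat\tau_n,\widehat W)=(\tau_n\Pi_t,\,WT\Pi)$ for some permutation matrix $\Pi_t$ of order $t$ and some nonsingular $\tau_n$-block diagonal matrix $T$. Here $\tau_n$ is regarded as a row vector, and $\Pi\in\mathbb{R}^{n\times n}$ is the block permutation matrix obtained from $\Pi_t$ by replacing, in its $j$-th row, the entry 1 by $I_{n_j}$ and the entries 0 by zero matrices of the appropriate sizes. For a finite family $\mathcal{B}=\{B_i\}_{i=1}^m$ of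 real $p\times p$ matrices, $\mathscr{N}(\mathcal{B})=\{Z\in\mathbb{R}^{p\times p} : B_iZ=Z^TB_i,\ i=1,\dots,m\}$, a real vector space. The symbol $\otimes$ denotes the Kronecker product. *)

(* Defs.v *)
From HB Require Import structures.
From mathcomp Require Import all_boot all_order all_algebra.
From mathcomp Require Import reals.
From mathcomp Require Export mxtens.

Set Implicit Arguments.
Unset Strict Implicit.
Unset Printing Implicit Defensive.

Import GRing.Theory.
Local Open Scope ring_scope.

Definition is_partition (n t : nat) (tau : t.-tuple nat) : Prop :=
  (forall j, 0 < tnth tau j)%N /\ (\sum_(j < t) tnth tau j)%N = n.

(* [\mxdiag] lives in order [\sum_j tnth tau j]; [e] only transports it to the
   propositionally equal order [n], and equality proofs on [nat] are unique. *)
Definition block_diagonal (R : realType) (n t : nat) (tau : t.-tuple nat)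
    (A : 'M[R]_n) : Prop :=
  exists (e : (\sum_(j < t) tnth tau j)%N = n)
         (D : forall j : 'I_t, 'M[R]_(tnth tau j)),
    A = castmx (e, e) (\mxdiag_(j < t) D j).

Definition JBD_solution (R : realType) (n m : nat) (A : 'I_m -> 'M[R]_n)
    (t : nat) (tau : t.-tuple nat) (W : 'M[R]_n) : Prop :=
  W \in unitmx /\ forall i, block_diagonal tau (W^T *m A i *m W).

Definition GJBD_solution (R : realType) (n m : nat) (A : 'I_m -> 'M[R]_n)
    (t : nat) (tau : t.-tuple nat) (W : 'M[R]_n) : Prop :=
  [/\ is_partition n tau,
      JBD_solution A tau W
    & forall (t' : nat) (tau' : t'.-tuple nat), is_partition n tau' ->
        (exists W' : 'M[R]_n, JBD_solution A tau' W') -> (t' <= t)%N].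

(* The row vector tau times the matrix P, over the semiring of naturals. *)
Definition part_mul (t : nat) (tau : t.-tuple nat) (P : 'M[nat]_t) :
    t.-tuple nat :=
  [tuple ((\row_(j < t) tnth tau j) *m P) 0 k | k < t].

(* When P is a permutation matrix and P j k = 1, the k-th entry of
   [part_mul tau P] is tnth tau j, so the [pid_mx] block is square and is the
   identity matrix. *)
Definition block_perm (R : realType) (t : nat) (tau : t.-tuple nat)
    (P : 'M[nat]_t) :
    'M[R]_((\sum_(j < t) tnth tau j)%N,
           (\sum_(k < t) tnth (part_mul tau P) k)%N) :=
  \mxblock_(j < t, k < t)
     (if P j k == 1%N
      then pid_mx (tnth tau j) : 'M[R]_(tnth tau j, tnth (part_mul tau P) k)
      else 0).

Definition equivalent_solutions (R : realType) (n : nat)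
    (t1 : nat) (tau1 : t1.-tuple nat) (W1 : 'M[R]_n)
    (t2 : nat) (tau2 : t2.-tuple nat) (W2 : 'M[R]_n) : Prop :=
  exists (P : 'M[nat]_t1) (T : 'M[R]_n)
         (er : (\sum_(j < t1) tnth tau1 j)%N = n)
         (ec : (\sum_(k < t1) tnth (part_mul tau1 P) k)%N = n),
    [/\ is_perm_mx P,
        T \in unitmx,
        block_diagonal tau1 T,
        tau2 = part_mul tau1 P :> seq nat
      & W2 = W1 *m T *m castmx (er, ec) (block_perm R tau1 P)].

Definition Ndefect (R : realType) (p : nat) (B Z : 'M[R]_p) : 'M[R]_p :=
  B *m Z - Z^T *m B.

Lemma Ndefect_is_linear (R : realType) (p : nat) (B : 'M[R]_p) :
  linear (Ndefect B).
Proof.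
move=> a Z Y; rewrite /Ndefect linearP /= linearP mulmxDl /= -scalemxAl.
by rewrite scalerBr opprD addrACA.
Qed.

HB.instance Definition _ (R : realType) (p : nat) (B : 'M[R]_p) :=
  GRing.isLinear.Build R 'M[R]_p 'M[R]_p _ (Ndefect B) (Ndefect_is_linear B).

Definition Nspace (R : realType) (m p : nat) (B : 'I_m -> 'M[R]_p) :
    {vspace 'M[R]_p} :=
  (\bigcap_(i < m) lker (linfun (Ndefect (B i))))%VS.

Lemma NspaceP (R : realType) (m p : nat) (B : 'I_m -> 'M[R]_p) (Z : 'M[R]_p) :
  reflect (forall i, B i *m Z = Z^T *m B i) (Z \in Nspace B).
Proof.
rewrite /Nspace memvE; apply: (iffP subv_bigcapP) => H i.
  have := H i isT; rewrite -memvE memv_ker lfunE /= /Ndefect subr_eq0.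
  by move/eqP.
by move=> _; rewrite -memvE memv_ker lfunE /= /Ndefect H subrr.
Qed.

Definition Mjk (R : realType) (m p q : nat) (Aj : 'I_m -> 'M[R]_p)
    (Ak : 'I_m -> 'M[R]_q) : 'M[R]_(q * p + q * p) :=
  \sum_(i < m)
    block_mx
      (1%:M *t ((Aj i)^T *m Aj i + Aj i *m (Aj i)^T))
      (Ak i *t Aj i + (Ak i)^T *t (Aj i)^T)
      (Ak i *t Aj i + (Ak i)^T *t (Aj i)^T)
      (((Ak i)^T *m Ak i + Ak i *m (Ak i)^T) *t 1%:M).

(* Main.v *)
Require Import Defs.
From mathcomp Require Import all_boot all_order all_fingroup all_algebra reals ring.

Set Implicit Arguments.
Unset Strict Implicit.
Unset Printing Implicit Defensive.

(* With E_j the block projections of tau and F_j = W E_j W^-1, solutions of the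
   JBD problem are the complete systems of nonzero orthogonal idempotents lying
   in N(A), and two solutions are equivalent iff their systems agree up to a
   permutation. Statements (2) and (3) both say that every Z in
   N(W^T A W) is block diagonal: the blocks of Z decouple into the N(A_j) and,
   for j < k, the pairs (Z_jk, Z_kj), and M_jk is the Gram matrix of the linear
   system satisfied by (Z_jk^T, -Z_kj).
   If all Z are block diagonal, the F_j commute with N(A); since t is maximal,
   F_j has no proper sub-idempotent in N(A), so each idempotent of another
   solution is one of the F_j. Conversely, if Z in N(W^T A W) has Z_jk <> 0,
   then K = E_j Z - Z E_j satisfies (W^T A_i W) K = - K^T (W^T A_i W), so the
   Cayley transform G = (c + K)(c - K)^-1 preserves W^T A_i W by congruence and
   (tau, W G) is again a solution; but both G_jj and some other block of the
   j-th block row of G are nonzero, so it is not equivalent to (tau, W). *)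

Import GRing.Theory Num.Theory.
Local Open Scope ring_scope.

(** * Block selection matrices *)

Section BlockSelection.
Variables (R : realType) (t : nat) (p : 'I_t -> nat).

(** The rows of the identity belonging to block [j], with columns transported to order [n]: the
    (j,k) block of [A] is [bsel e j *m A *m (bsel e k)^T], so casts stay out of later proofs. *)
Definition bsel n (e : (\sum_(j < t) p j)%N = n) (j : 'I_t) : 'M[R]_(p j, n) :=
  castmx (erefl, e) (submxcol 1%:M j).

Variables (n : nat) (e : (\sum_(j < t) p j)%N = n).

(** Rows and columns may be cut by different partitions, as happens for [block_perm]. *)
Lemma bsel_mul_tr_block q (q_ : 'I_q -> nat) n' (e' : (\sum_(j < q) q_ j)%N = n')
    (D : forall j k, 'M[R]_(p j, q_ k)) j k (P' : 'M[R]_(q_ k, n')) :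
  P' = castmx (erefl, e') (submxcol 1%:M k) ->
  bsel e j *m castmx (e, e') (\mxblock_(j, k) D j k) *m P'^T = D j k.
Proof.
move=> ->; rewrite /bsel; case: _ / e; case: _ / e'; rewrite !castmx_id.
rewrite submxcol_mul mul1mx tr_submxcol trmx1 mul_submxrow mulmx1.
by rewrite -submxblockEv mxblockK.
Qed.

Lemma bsel_tr j k :
  bsel e j *m (bsel e k)^T = if j == k then conform_mx 0 (1%:M : 'M_(p j)) else 0.
Proof.
(* Insert the identity, to be read as the block diagonal matrix with identity blocks. *)
have -> : bsel e j = bsel e j *m castmx (e, e) 1%:M.
  by case: _ / e; rewrite castmx_id mulmx1.
by rewrite -mxdiagZ (bsel_mul_tr_block (e' := e)).
Qed.

Lemma bsel_id j : bsel e j *m (bsel e j)^T = 1%:M.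
Proof. by rewrite bsel_tr eqxx conform_mx_id. Qed.

Lemma bsel_ortho j k : j != k -> bsel e j *m (bsel e k)^T = 0.
Proof. by rewrite bsel_tr => /negPf->. Qed.

Lemma bsel_sum : \sum_j (bsel e j)^T *m bsel e j = 1%:M.
Proof.
rewrite /bsel; case: _ / e.
transitivity (\sum_j (submxrow 1%:M j *m submxcol 1%:M j) : 'M[R]_(\sum_j p j)).
  by apply: eq_bigr => j _; rewrite castmx_id tr_submxcol trmx1.
by rewrite -mul_mxrow_mxcol submxrowK submxcolK mulmx1.
Qed.

Lemma bsel_inj (Z Y : 'M[R]_n) :
  (forall j k, bsel e j *m Z *m (bsel e k)^T = bsel e j *m Y *m (bsel e k)^T) ->
  Z = Y.
Proof.
move=> h.
suff E X : X = \sum_j \sum_k (bsel e j)^T *m (bsel e j *m X *m (bsel e k)^T) *m bsel e k.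
  by rewrite [Z]E [Y]E; under eq_bigr do under eq_bigr do rewrite h.
transitivity (1%:M *m X *m 1%:M); first by rewrite mul1mx mulmx1.
rewrite -!bsel_sum !mulmx_suml; apply: eq_bigr => j _.
by rewrite mulmx_sumr; apply: eq_bigr => k _; rewrite !mulmxA.
Qed.

Lemma bsel_diag (D : forall j, 'M[R]_(p j)) j k :
  bsel e j *m castmx (e, e) (\mxdiag_j D j) *m (bsel e k)^T =
  if j == k then conform_mx 0 (D j) else 0.
Proof. by rewrite (bsel_mul_tr_block (e' := e)). Qed.

Lemma bsel_diagE (D : forall j, 'M[R]_(p j)) :
  castmx (e, e) (\mxdiag_j D j) = \sum_j (bsel e j)^T *m D j *m bsel e j.
Proof.
apply: bsel_inj => j k; rewrite bsel_diag mulmx_sumr mulmx_suml (bigD1 j) //=.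
rewrite big1 => [|l lj]; last by rewrite !mulmxA bsel_ortho ?mul0mx // eq_sym.
rewrite !mulmxA bsel_id mul1mx -mulmxA addr0.
case: eqVneq => [<-|jk]; first by rewrite bsel_id mulmx1 conform_mx_id.
by rewrite bsel_ortho ?mulmx0.
Qed.

End BlockSelection.

Arguments bsel_ortho {R t p n e j k}.

Lemma block_diagonalP (R : realType) (n t : nat) (tau : t.-tuple nat)
   (e : (\sum_(j < t) tnth tau j)%N = n) (A : 'M[R]_n) :
  block_diagonal tau A <->
  (forall j k, j != k -> bsel R e j *m A *m (bsel R e k)^T = 0).
Proof.
split=> [[e' [D ->]] j k jk|h].
  by rewrite (eq_irrelevance e' e) bsel_diag (negPf jk).
exists e, (fun j => bsel R e j *m A *m (bsel R e j)^T).
apply: (bsel_inj (e := e)) => j k; rewrite bsel_diag; case: eqVneq => [<-|/h //].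
by rewrite conform_mx_id.
Qed.

(** * Gram matrices, Kronecker products and [Mjk] *)

Lemma mulmx_tr_ge0 (R : realDomainType) n (v : 'rV[R]_n) : 0 <= (v *m v^T) 0 0.
Proof. by rewrite mxE; apply: sumr_ge0 => l _; rewrite mxE -expr2 sqr_ge0. Qed.

Lemma mulmx_tr_eq0 (R : realDomainType) n (v : 'rV[R]_n) :
  (v *m v^T) 0 0 = 0 -> v = 0.
Proof.
rewrite mxE => h; apply/rowP => k; rewrite mxE; apply/eqP; rewrite -sqrf_eq0.
have sq_ge0 i : true -> 0 <= v 0 i * v^T i 0 by rewrite mxE -expr2 sqr_ge0.
by have /eqP := psumr_eq0P sq_ge0 h (i := k) isT; rewrite mxE.
Qed.

(** If [v] is in the kernel, multiplying by [v^T] gives a sum of squared norms of the [v *m H i]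
    equal to 0, so each of them vanishes. *)
Lemma gram_unitP (R : realFieldType) (m N N' : nat) (H : 'I_m -> 'M[R]_(N, N')) :
  (\sum_i H i *m (H i)^T) \in unitmx <->
  (forall v : 'rV_N, (forall i, v *m H i = 0) -> v = 0).
Proof.
rewrite -row_free_unit; split=> [fr v vH|vH].
  apply: (row_free_inj fr); rewrite mul0mx mulmx_sumr big1 // => i _.
  by rewrite mulmxA vH mul0mx.
apply: inj_row_free => v /(congr1 (fun w => (w *m v^T) 0 0)).
rewrite mul0mx [RHS]mxE mulmx_sumr mulmx_suml summxE => h; apply: vH => i.
apply: mulmx_tr_eq0; rewrite trmx_mul mulmxA -(mulmxA v).
apply: (psumr_eq0P _ h) => // k _; rewrite mulmxA -mulmxA -trmx_mul.
exact: mulmx_tr_ge0.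
Qed.

(* [tensmx] flattens pairs of indices with [mxtens_index], whereas [mxvec] uses
   the enumeration of the product type, hence this separate vectorisation. *)
Definition tensvec (R : Type) q p (x : 'M[R]_(q, p)) : 'rV[R]_(q * p) :=
  \row_k x (mxtens_unindex k).1 (mxtens_unindex k).2.

Definition vectens (R : Type) q p (v : 'rV[R]_(q * p)) : 'M[R]_(q, p) :=
  \matrix_(i, j) v 0 (mxtens_index (i, j)).

Lemma tensvecK (R : Type) q p : cancel (@tensvec R q p) (@vectens R q p).
Proof. by move=> x; apply/matrixP => i j; rewrite !mxE mxtens_indexK. Qed.

Lemma vectensK (R : Type) q p : cancel (@vectens R q p) (@tensvec R q p).
Proof.
by move=> v; apply/rowP => k; rewrite !mxE -surjective_pairing mxtens_unindexK.
Qed.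

Lemma tensvec0 (R : pzRingType) q p : tensvec (0 : 'M[R]_(q, p)) = 0.
Proof. by apply/rowP => k; rewrite !mxE. Qed.

Lemma tensvecD (R : pzRingType) q p (x y : 'M[R]_(q, p)) :
  tensvec (x + y) = tensvec x + tensvec y.
Proof. by apply/rowP => k; rewrite !mxE. Qed.

Lemma tensvec_mul (R : comPzRingType) q p q' p' (x : 'M[R]_(q, p))
    (A : 'M[R]_(q, q')) (B : 'M[R]_(p, p')) :
  tensvec x *m (A *t B) = tensvec (A^T *m x *m B).
Proof.
apply/rowP => k; rewrite !mxE.
rewrite (reindex (@mxtens_index q p)) /=; last first.
  by exists (@mxtens_unindex q p) => i _; rewrite (mxtens_indexK, mxtens_unindexK).
under [RHS]eq_bigr do rewrite mxE mulr_suml.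
rewrite exchange_big pair_bigA /=.
apply: eq_bigr => -[i j] _; rewrite !mxE mxtens_indexK /= mulrA.
by congr (_ * _); rewrite mulrC.
Qed.

Lemma Mjk_unitP (R : realType) (m p q : nat) (Aj : 'I_m -> 'M[R]_p)
    (Ak : 'I_m -> 'M[R]_q) :
  Mjk Aj Ak \in unitmx <->
  (forall x u : 'M[R]_(q, p),
     (forall i, x *m (Aj i)^T + (Ak i)^T *m u = 0) ->
     (forall i, x *m Aj i + Ak i *m u = 0) -> x = 0 /\ u = 0).
Proof.
(* The two block columns encode the two equations on [x] and [u]: right multiplication of the
   vectorised pair by [H i] yields their left-hand sides. *)
pose H i := block_mx (1%:M *t (Aj i)^T) (1%:M *t Aj i)
                     (Ak i *t 1%:M) ((Ak i)^T *t 1%:M) : 'M_(q * p + q * p).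
have -> : Mjk Aj Ak = \sum_i H i *m (H i)^T.
  apply: eq_bigr => i _; rewrite /H tr_block_mx mulmx_block.
  rewrite !trmx_tens !trmx1 !trmxK !tensmx_mul !mul1mx !mulmx1.
  rewrite addrC [1%:M *t _ + _]addrC.
  congr block_mx; apply/matrixP => a b; rewrite !mxE; ring.
rewrite gram_unitP.
have E i x u : row_mx (tensvec x) (tensvec u) *m H i =
  row_mx (tensvec (x *m (Aj i)^T + (Ak i)^T *m u)) (tensvec (x *m Aj i + Ak i *m u)).
  rewrite mul_row_block !tensvec_mul !trmx1 !mul1mx !mulmx1 trmxK.
  by rewrite !tensvecD.
split=> [h x u h1 h2|h v vH].
  have : row_mx (tensvec x) (tensvec u) = 0.
    by apply: h => i; rewrite E h1 h2 tensvec0 row_mx0.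
  rewrite -row_mx0 => /eq_row_mx[hx hu].
  by split; [rewrite -[x]tensvecK hx|rewrite -[u]tensvecK hu]; apply/matrixP=> a b; rewrite !mxE.
rewrite -[v]hsubmxK -[lsubmx v]vectensK -[rsubmx v]vectensK.
have [||-> ->] := h (vectens (lsubmx v)) (vectens (rsubmx v)); last by rewrite tensvec0 row_mx0.
all: move=> i; have := vH i; rewrite -{1}[v]hsubmxK -{1}[lsubmx v]vectensK -{1}[rsubmx v]vectensK E.
all: rewrite -row_mx0 => /eq_row_mx[h1 h2].
  by rewrite -[LHS]tensvecK h1; apply/matrixP=> a b; rewrite !mxE.
by rewrite -[LHS]tensvecK h2; apply/matrixP=> a b; rewrite !mxE.
Qed.

(** * Blocks of elements of N for a block diagonal family *)

Section DiagFamily.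
Variables (R : realType) (n m t : nat) (tau : t.-tuple nat).
Variables (e : (\sum_(j < t) tnth tau j)%N = n).
Variables (B : 'I_m -> forall j : 'I_t, 'M[R]_(tnth tau j)).
Local Notation P := (bsel R e).
Local Notation C := (fun i => castmx (e, e) (\mxdiag_(j < t) B i j)).

Lemma bsel_mul_diag i j : P j *m C i = B i j *m P j.
Proof.
rewrite /= bsel_diagE mulmx_sumr (bigD1 j) //= big1 ?addr0 => [|l lj].
  by rewrite !mulmxA bsel_id mul1mx.
by rewrite !mulmxA bsel_ortho ?mul0mx // eq_sym.
Qed.

Lemma diag_mul_tr_bsel i j : C i *m (P j)^T = (P j)^T *m B i j.
Proof.
rewrite /= bsel_diagE mulmx_suml (bigD1 j) //= big1 ?addr0 => [|l lj].
  by rewrite -mulmxA bsel_id mulmx1.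
by rewrite -mulmxA bsel_ortho ?mulmx0.
Qed.

Lemma Nspace_diagP (Z : 'M[R]_n) :
  Z \in Nspace C <->
  forall i j k, B i j *m (P j *m Z *m (P k)^T) = (P k *m Z *m (P j)^T)^T *m B i k.
Proof.
have El i j k : B i j *m (P j *m Z *m (P k)^T) = P j *m (C i *m Z) *m (P k)^T.
  by rewrite !mulmxA bsel_mul_diag.
have Er i j k : (P k *m Z *m (P j)^T)^T *m B i k = P j *m (Z^T *m C i) *m (P k)^T.
  by rewrite !trmx_mul trmxK -!mulmxA diag_mul_tr_bsel.
split=> [/NspaceP h i j k|h]; first by rewrite El Er h.
apply/NspaceP => i; apply: (bsel_inj (e := e)) => j k.
by rewrite -El -Er.
Qed.

Lemma Nspace_diag_Mjk :
  (forall Z, Z \in Nspace C -> block_diagonal tau Z) <->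
  (forall j k : 'I_t, (j < k)%N ->
     Mjk (fun i => B i j) (fun i => B i k) \in unitmx).
Proof.
split=> [h j k jk|h Z /Nspace_diagP ZN].
  have njk : j != k by rewrite neq_ltn jk.
  have nkj : k != j by rewrite eq_sym.
  apply/Mjk_unitP => x u h1 h2.
  (* All blocks of [Z] vanish except possibly [x^T] at (j,k) and [- u] at (k,j), so only the
     equations at these two positions are nontrivial. *)
  pose Z := (P j)^T *m x^T *m P k - (P k)^T *m u *m P j.
  have ZE a b : P a *m Z *m (P b)^T =
      P a *m (P j)^T *m x^T *m (P k *m (P b)^T)
      - P a *m (P k)^T *m u *m (P j *m (P b)^T).
    by rewrite /Z mulmxBr mulmxBl !mulmxA.
  have Zjk : P j *m Z *m (P k)^T = x^T.
    by rewrite ZE !bsel_id (bsel_ortho njk) mul1mx mulmx1 !mul0mx subr0.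
  have Zkj : P k *m Z *m (P j)^T = - u.
    by rewrite ZE !bsel_id (bsel_ortho nkj) mul1mx mulmx1 !mul0mx sub0r.
  have ZN : Z \in Nspace C.
    apply/Nspace_diagP => i a b.
    have [->{a}|aj] := eqVneq a j.
      have [->{b}|bk] := eqVneq b k.
        rewrite Zjk Zkj; apply/eqP; rewrite linearN /= mulNmx -addr_eq0.
        by rewrite -[B i k]trmxK -trmx_mul -[B i j]trmxK -trmx_mul -linearD h1 linear0.
      have kb : k != b by rewrite eq_sym.
      rewrite !ZE (bsel_ortho njk) (bsel_ortho nkj) (bsel_ortho kb) (bsel_ortho bk).
      by rewrite !(mulmx0, mul0mx, subr0, trmx0).
    have [->{a aj}|ak] := eqVneq a k.
      have [->{b}|bj] := eqVneq b j.
        rewrite Zjk Zkj trmxK mulmxN; apply/eqP; rewrite eq_sym -addr_eq0.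
        by rewrite h2.
      have jb : j != b by rewrite eq_sym.
      rewrite !ZE (bsel_ortho nkj) (bsel_ortho njk) (bsel_ortho jb) (bsel_ortho bj).
      by rewrite !(mulmx0, mul0mx, subr0, trmx0).
    have ja : j != a by rewrite eq_sym.
    have ka : k != a by rewrite eq_sym.
    rewrite !ZE (bsel_ortho aj) (bsel_ortho ak) (bsel_ortho ja) (bsel_ortho ka).
    by rewrite !(mulmx0, mul0mx, subr0, trmx0).
  have /(block_diagonalP e) Zd := h _ ZN.
  split; first by rewrite -[x]trmxK -Zjk Zd // trmx0.
  by rewrite -[u]opprK -Zkj Zd // oppr0.
apply/(block_diagonalP e).
have lt0 (j k : 'I_t) : (j < k)%N ->
    P j *m Z *m (P k)^T = 0 /\ P k *m Z *m (P j)^T = 0.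
  move=> jk; have /Mjk_unitP/(_ (P j *m Z *m (P k)^T)^T (- (P k *m Z *m (P j)^T))) := h _ _ jk.
  case=> [i|i|hx /eqP].
  - rewrite -trmx_mul ZN mulmxN trmx_mul trmxK.
    by rewrite subrr.
  - by rewrite -ZN mulmxN subrr.
  by rewrite oppr_eq0 => /eqP ->; rewrite -[_ *m (P k)^T]trmxK hx trmx0.
move=> j k; rewrite neq_ltn => /orP[/lt0[]//|/lt0[]//].
Qed.

End DiagFamily.

(** * Dimension count *)

Lemma Nspace_congr (R : realType) (n m : nat) (A : 'I_m -> 'M[R]_n) (W Z : 'M[R]_n) :
  W \in unitmx ->
  (W *m Z *m invmx W \in Nspace A) <-> (Z \in Nspace (fun i => W^T *m A i *m W)).
Proof.
move=> Wu; have WTu : W^T \in unitmx by rewrite unitmx_tr.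
have El i : W^T *m A i *m W *m Z = W^T *m (A i *m (W *m Z *m invmx W)) *m W.
  by rewrite !mulmxA mulmxKV.
have Er i : Z^T *m (W^T *m A i *m W) = W^T *m ((W *m Z *m invmx W)^T *m A i) *m W.
  by rewrite !trmx_mul trmx_inv !mulmxA mulmxV // mul1mx.
split=> /NspaceP h; apply/NspaceP => i; first by rewrite El Er h.
apply: (can_inj (mulKmx WTu)); apply: (can_inj (mulmxK Wu)).
by rewrite -El -Er h.
Qed.

(** Each N(A_j) embeds in N(A) by placing a matrix in the j-th diagonal block and conjugating by
    [W]. The images form a direct sum inside N(A), so the dimensions agree iff this sum exhausts
    N(A), that is, iff there are no off-diagonal blocks. *)
Lemma dim_Nspace (R : realType) (n m t : nat) (tau : t.-tuple nat)
    (e : (\sum_(j < t) tnth tau j)%N = n) (A : 'I_m -> 'M[R]_n) (W : 'M[R]_n)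
    (B : 'I_m -> forall j : 'I_t, 'M[R]_(tnth tau j)) :
  W \in unitmx ->
  (forall i, W^T *m A i *m W = castmx (e, e) (\mxdiag_(j < t) B i j)) ->
  \dim (Nspace A) = (\sum_(j < t) \dim (Nspace (fun i => B i j)))%N <->
  (forall Z, Z \in Nspace (fun i => castmx (e, e) (\mxdiag_(j < t) B i j)) ->
     block_diagonal tau Z).
Proof.
move=> Wu defB; set C := fun i => castmx _ _.
have NC Z : (W *m Z *m invmx W \in Nspace A) <-> Z \in Nspace C.
  rewrite (Nspace_congr _ _ Wu); split=> /NspaceP h; apply/NspaceP => i;
    by move: (h i); rewrite /= defB.
pose P := bsel R e.
pose emb j := linfun (mulmxr (P j *m invmx W) \o mulmx (W *m (P j)^T)).
have embE j X : emb j X = W *m ((P j)^T *m X *m P j) *m invmx W.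
  by rewrite lfunE /= !mulmxA.
have conjK X : invmx W *m (W *m X *m invmx W) *m W = X.
  by rewrite !mulmxA mulVmx // mul1mx mulmxKV.
have embK j X : P j *m (invmx W *m emb j X *m W) *m (P j)^T = X.
  by rewrite embE conjK !mulmxA bsel_id mul1mx -mulmxA bsel_id mulmx1.
have embN j k X : j != k -> P j *m (invmx W *m emb k X *m W) = 0.
  by move=> jk; rewrite embE conjK !mulmxA bsel_ortho // !mul0mx.
pose U j := (emb j @: Nspace (fun i => B i j))%VS.
have dimU j : \dim (U j) = \dim (Nspace (fun i => B i j)).
  apply: limg_dim_eq; suff /eqP-> : lker (emb j) == 0%VS by rewrite capv0.
  by apply/lker0P => X Y XY; rewrite -(embK j X) XY embK.
(* Undoing the conjugation and selecting block row [j] kills every summand other than the j-th. *)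
have dirU : directv (\sum_j U j).
  apply/directv_sum_independent => us usU us0 j _.
  have /memv_imgP[X _ uj] := usU j isT.
  rewrite uj -[X](embK j) -uj.
  suff -> : P j *m (invmx W *m us j *m W) = 0 by rewrite mul0mx linear0.
  have : P j *m (invmx W *m (\sum_j us j) *m W) = 0 by rewrite us0 mulmx0 mul0mx mulmx0.
  rewrite mulmx_sumr mulmx_suml mulmx_sumr (bigD1 j) //= big1 ?addr0 // => k kj.
  by have /memv_imgP[Y _ ->] := usU k isT; rewrite embN // eq_sym.
have subU : (\sum_j U j <= Nspace A)%VS.
  apply/subv_sumP => j _; apply/subvP => _ /memv_imgP[X /NspaceP XN ->].
  rewrite embE; apply/NC/Nspace_diagP => i k l.
  have blockE a b : bsel R e a *m ((P j)^T *m X *m P j) *m (bsel R e b)^T =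
      (bsel R e a *m (P j)^T) *m X *m (P j *m (bsel R e b)^T).
    by rewrite !mulmxA.
  rewrite !blockE; have [->{k}|kj] := eqVneq k j; last first.
    have jk : j != k by rewrite eq_sym.
    by rewrite (bsel_ortho kj) (bsel_ortho jk) !(mulmx0, mul0mx, trmx0).
  have [->{l}|lj] := eqVneq l j; last first.
    have jl : j != l by rewrite eq_sym.
    by rewrite (bsel_ortho lj) (bsel_ortho jl) !(mulmx0, mul0mx, trmx0).
  by rewrite !bsel_id !mul1mx !mulmx1 XN.
have -> : (\sum_(j < t) \dim (Nspace (fun i => B i j)))%N = \dim (\sum_j U j).
  by rewrite (directvP dirU) /=; apply: eq_bigr => j _; rewrite dimU.
split=> [dimE Z ZN|diag].
  (* The inclusion [subU] together with equal dimensions forces equality. *)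
  have NU : Nspace A = (\sum_j U j)%VS.
    by apply/eqP; rewrite eq_sym eqEdim subU dimE /=.
  have : W *m Z *m invmx W \in Nspace A by apply/NC.
  rewrite NU => /memv_sumP[us usU WZ].
  apply/(block_diagonalP e) => j k jk.
  have -> : Z = invmx W *m (\sum_i us i) *m W.
    by rewrite -WZ conjK.
  rewrite mulmx_sumr !mulmx_suml mulmx_sumr mulmx_suml big1 // => l _.
  have /memv_imgP[Y _ ->] := usU l isT.
  have [jl|jl] := eqVneq j l; last by rewrite [_ *m (_ *m W)]embN // mul0mx.
  have lk : l != k by rewrite -jl.
  by rewrite embE conjK -!mulmxA (bsel_ortho lk) !mulmx0.
suff -> : Nspace A = (\sum_j U j)%VS by [].
apply: subv_anti; rewrite subU andbT; apply/subvP => Z ZN.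
pose Y := invmx W *m Z *m W.
have ZE : Z = W *m Y *m invmx W by rewrite /Y !mulmxA mulmxV // mul1mx mulmxK.
have YN : Y \in Nspace C by apply/NC; rewrite -ZE.
have /(block_diagonalP e) Yd := diag _ YN.
(* A block diagonal [Y] is the sum of its diagonal blocks, each put back in place. *)
have -> : Z = \sum_j emb j (P j *m Y *m (P j)^T).
  under eq_bigr do rewrite embE.
  rewrite -mulmx_suml -mulmx_sumr ZE; congr (_ *m _ *m _).
  apply: (bsel_inj (e := e)) => j k.
  rewrite mulmx_sumr mulmx_suml (bigD1 j) //= big1 => [|l lj]; last first.
    have jl : j != l by rewrite eq_sym.
    by rewrite !mulmxA (bsel_ortho jl) !mul0mx.
  rewrite addr0 !mulmxA bsel_id mul1mx -[RHS]mulmxA.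
  have [<-|jk] := eqVneq j k; first by rewrite bsel_id mulmx1.
  by rewrite bsel_ortho // mulmx0 -(Yd _ _ jk) !mulmxA.
apply: memv_sumr => j _; apply/memv_img/NspaceP => i.
by move/Nspace_diagP: YN => ->.
Qed.

(** * Cayley transforms *)

Lemma scalar_sub_unit (F : fieldType) n (K : 'M[F]_n) a :
  ~~ root (char_poly K) a -> a%:M - K \in unitmx.
Proof.
rewrite -eigenvalue_root_char -row_free_unit => nev.
apply: inj_row_free => v /eqP; rewrite mulmxBr mul_mx_scalar subr_eq0 eq_sym => /eqP vK.
apply: contraNeq nev => v0; apply/eigenvalueP; by exists v.
Qed.

(** The product [p] of the two characteristic polynomials has fewer than [size p] roots, so one of
    the squares of 1, ..., [size p] is not a root. This will be applied to the square of a matrix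
    [K], where [(c ^+ 2)%:M - K *m K] factors as [(c%:M + K) *m (c%:M - K)]. *)
Lemma exists_sqr_unit (F : realFieldType) n (K : 'M[F]_n) :
  exists c : F, [/\ c != 0, (c ^+ 2)%:M - K \in unitmx & (c ^+ 2)%:M + K \in unitmx].
Proof.
pose p := char_poly K * char_poly (- K).
have p0 : p != 0 by rewrite mulf_neq0 ?monic_neq0 ?char_poly_monic.
pose rs : seq F := [seq i.+1%:R ^+ 2 | i <- iota 0 (size p)].
have : ~~ all (root p) rs.
  apply/negP => /(max_poly_roots p0); rewrite size_map size_iota ltnn => h.
  have : uniq rs.
    rewrite map_inj_uniq ?iota_uniq // => i j /eqP.
    by rewrite eqrXn2 ?ler0n // eqr_nat => /eqP[].
  by move/h.
move/allPn => [_ /mapP[i _ ->]]; rewrite rootM negb_or => /andP[h1 h2].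
exists i.+1%:R; rewrite pnatr_eq0; split=> //; first exact: scalar_sub_unit.
by rewrite -[K]opprK; apply: scalar_sub_unit.
Qed.

(** The hypothesis on [K] lets [A] exchange the factors, [A *m Kp = Km^T *m A] and
    [A *m Km = Kp^T *m A]; as [Kp] and [Km] commute, everything but [A] cancels. *)
Lemma cayley_congr (R : comUnitRingType) n (A K : 'M[R]_n) c :
  A *m K = - (K^T *m A) -> c%:M - K \in unitmx ->
  let G := (c%:M + K) *m invmx (c%:M - K) in G^T *m A *m G = A.
Proof.
move=> AK Ku G; set Kp := c%:M + K; set Km := c%:M - K.
have KpE : (Kp^T *m A) = A *m Km.
  by rewrite linearD /= tr_scalar_mx mulmxDl mulmxBr AK opprK scalar_mxC.
have KmE : A *m Kp = Km^T *m A.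
  by rewrite linearB /= tr_scalar_mx mulmxBl mulmxDr AK scalar_mxC.
have KC : Kp *m Km = Km *m Kp.
  rewrite /Kp /Km !mulmxDl !mulmxDr !mulmxN !mulNmx !mul_scalar_mx !mul_mx_scalar.
  by rewrite addrACA.
have KmTu : Km^T \in unitmx by rewrite unitmx_tr.
rewrite /G trmx_mul trmx_inv -!mulmxA (mulmxA A) KmE -(mulmxA _ A) (mulmxA Kp^T).
rewrite -trmx_mul -KC trmx_mul -!mulmxA mulKmx //.
by rewrite mulmxA KpE mulmxK.
Qed.

(** * Block pattern of an equivalence *)

Lemma block_perm_block (R : realType) n t (tau : t.-tuple nat) (P : 'M[nat]_t)
   (er : (\sum_(j < t) tnth tau j)%N = n)
   (ec : (\sum_(k < t) tnth (part_mul tau P) k)%N = n) j k :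
  bsel R er j *m castmx (er, ec) (block_perm R tau P) *m (bsel R ec k)^T =
  if P j k == 1%N then pid_mx (tnth tau j) else 0.
Proof. exact: bsel_mul_tr_block. Qed.

Lemma block_diagonal_row (R : realType) n t (tau : t.-tuple nat)
   (e : (\sum_(j < t) tnth tau j)%N = n) (T : 'M[R]_n) j :
  block_diagonal tau T ->
  bsel R e j *m T = bsel R e j *m T *m (bsel R e j)^T *m bsel R e j.
Proof.
move/(block_diagonalP e) => Td.
rewrite -[LHS]mulmx1 -(bsel_sum _ e) mulmx_sumr (bigD1 j) //= big1 ?addr0 ?mulmxA //.
by move=> k kj; rewrite mulmxA Td 1?eq_sym // mul0mx.
Qed.

(** Cancelling [W] shows that [G] is a block diagonal matrix times a block permutation, so each
    block row of [G] has at most one nonzero block. *)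
Lemma equivalent_block_monomial (R : realType) n t (tau : t.-tuple nat)
   (e : (\sum_(j < t) tnth tau j)%N = n) (W G : 'M[R]_n) j :
  W \in unitmx -> equivalent_solutions tau W tau (W *m G) ->
  bsel R e j *m G *m (bsel R e j)^T != 0 ->
  forall k, k != j -> bsel R e j *m G *m (bsel R e k)^T = 0.
Proof.
move=> Wu [P [T [er [ec [/is_perm_mxP[s Ps] Tu Td tauP]]]]].
rewrite -mulmxA => /(can_inj (mulKmx Wu)) ->.
have {}tauP : tau = part_mul tau P by apply: val_inj.
have entry k : P j k != 1%N ->
    bsel R e j *m (T *m castmx (er, ec) (block_perm R tau P)) *m (bsel R e k)^T = 0.
  move=> Pjk; rewrite mulmxA (block_diagonal_row _ _ Td) -!mulmxA.
  suff -> : bsel R e j *m (castmx (er, ec) (block_perm R tau P) *m (bsel R e k)^T) = 0.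
    by rewrite !mulmx0.
  (* The columns of the block permutation are cut by [part_mul tau P], which equals [tau] only
     propositionally; a generic [tau'] makes the substitution possible. *)
  have gen tau' (e' : (\sum_(j < t) tnth tau' j)%N = n) : tau' = part_mul tau P ->
      bsel R e j *m (castmx (er, ec) (block_perm R tau P) *m (bsel R e' k)^T) = 0.
    move=> tauE; subst tau'; rewrite (eq_irrelevance e' ec) (eq_irrelevance e er) mulmxA.
    by rewrite block_perm_block (negPf Pjk).
  by rewrite gen.
move=> jj k kj; apply: (entry); apply: contraNneq kj => Pjk.
have : P j j == 1%N by apply: contraNT jj => /entry ->; rewrite eqxx.
have PE l : P j l == 1%N -> s j = l by rewrite Ps !mxE; case: (s j =P l).
by move/PE => sj; rewrite -[in eqbRHS]sj (PE k) ?Pjk.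
Qed.

(** * Block projections, and block diagonality from equivalence *)

Section BlockProjection.
Variables (R : realType) (t : nat) (p : 'I_t -> nat) (n : nat).
Variables (e : (\sum_(j < t) p j)%N = n).

Definition bproj j : 'M[R]_n := (bsel R e j)^T *m bsel R e j.

Lemma bprojK j : bproj j *m bproj j = bproj j.
Proof. by rewrite mulmxA -(mulmxA _ _ (bsel R e j)^T) bsel_id mulmx1. Qed.

Lemma bproj_ortho j k : j != k -> bproj j *m bproj k = 0.
Proof. by move=> jk; rewrite mulmxA -(mulmxA _ _ (bsel R e k)^T) bsel_ortho // mulmx0 mul0mx. Qed.

Lemma bproj_sum : \sum_j bproj j = 1%:M.
Proof. exact: bsel_sum. Qed.

Lemma bsel_bproj j : bsel R e j *m bproj j = bsel R e j.
Proof. by rewrite mulmxA bsel_id mul1mx. Qed.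

Lemma bproj_bsel j : bproj j *m (bsel R e j)^T = (bsel R e j)^T.
Proof. by rewrite -mulmxA bsel_id mulmx1. Qed.

Lemma tr_bproj j : (bproj j)^T = bproj j.
Proof. by rewrite trmx_mul trmxK. Qed.

Lemma bproj_neq0 j : (0 < p j)%N -> bproj j != 0.
Proof.
move=> pj; apply: contraTneq pj => Ej; rewrite -leqNgt leqn0.
rewrite -(mxrank1 R (p j)) -(bsel_id R e) -bsel_bproj Ej.
by rewrite mulmx0 mul0mx mxrank0.
Qed.

End BlockProjection.

(** If the off-diagonal blocks vanish, E_j Z and Z E_j both equal E_j Z E_j. Conversely, commutation
    brings E_j next to the k-th selector, which it kills. *)
Lemma block_diagonal_commP (R : realType) (n t : nat) (tau : t.-tuple nat)
   (e : (\sum_(j < t) tnth tau j)%N = n) (Z : 'M[R]_n) :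
  block_diagonal tau Z <-> (forall j, bproj R e j *m Z = Z *m bproj R e j).
Proof.
rewrite (block_diagonalP e); split=> [Zd j|Zc j k jk].
  have EZE a b : bproj R e a *m Z *m bproj R e b =
      (bsel R e a)^T *m (bsel R e a *m Z *m (bsel R e b)^T) *m bsel R e b.
    by rewrite /bproj !mulmxA.
  have El : bproj R e j *m Z = bproj R e j *m Z *m bproj R e j.
    rewrite -[LHS]mulmx1 -(bproj_sum R e) mulmx_sumr (bigD1 j) //= big1 ?addr0 // => k kj.
    by rewrite EZE Zd 1?eq_sym // mulmx0 mul0mx.
  have Er : Z *m bproj R e j = bproj R e j *m Z *m bproj R e j.
    rewrite -[LHS]mul1mx -(bproj_sum R e) mulmx_suml (bigD1 j) //=.
    rewrite big1 ?addr0 => [|k kj]; first exact: mulmxA.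
    by rewrite (mulmxA _ Z) EZE Zd // mulmx0 mul0mx.
  by rewrite El Er.
by rewrite -(bsel_bproj R e j) -(mulmxA _ _ Z) Zc -!mulmxA bsel_ortho // !mulmx0.
Qed.

(** Relative to E = E_j, the commutator K is off-diagonal and K^2 commutes with E. Hence G (c^2 -
    K^2) = (c + K)^2 splits into c^2 + K^2, which commutes with E, and the off-diagonal part 2cK.
    The first part makes G_jj nonzero; equivalence then forces the j-th block row of the second to
    vanish, and Z_jk is one of its blocks up to the factor 2c. *)
Lemma equivalent_Nspace_block_diagonal (R : realType) (n m t : nat)
    (tau : t.-tuple nat) (e : (\sum_(j < t) tnth tau j)%N = n)
    (C : 'I_m -> 'M[R]_n) (W : 'M[R]_n) :
  (forall j, 0 < tnth tau j)%N -> W \in unitmx ->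
  (forall i, block_diagonal tau (C i)) ->
  (forall G, G \in unitmx -> (forall i, G^T *m C i *m G = C i) ->
     equivalent_solutions tau W tau (W *m G)) ->
  forall Z, Z \in Nspace C -> block_diagonal tau Z.
Proof.
move=> tau_gt0 Wu Cd eqW Z /NspaceP ZN; apply/(block_diagonalP e) => j k jk.
pose E := bproj R e j.
have CE i : C i *m E = E *m C i by have /(block_diagonal_commP e) -> := Cd i.
have EE : E *m E = E by exact: bprojK.
have ET : E^T = E by exact: tr_bproj.
have PE : bsel R e j *m E = bsel R e j by exact: bsel_bproj.
have EPk : E *m (bsel R e k)^T = 0 by rewrite -mulmxA bsel_ortho ?mulmx0.
have Edef : E = (bsel R e j)^T *m bsel R e j by [].
have E0 : E != 0 by exact: bproj_neq0.
clearbody E.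
have [K Kdef] : exists K, K = E *m Z - Z *m E by eexists.
have CK i : C i *m K = - (K^T *m C i).
  rewrite Kdef mulmxBr linearB /= mulmxBl opprB !trmx_mul ET !mulmxA CE ZN.
  by rewrite -(mulmxA E) ZN -!mulmxA CE.
have EK : E *m K = K - K *m E.
  rewrite Kdef mulmxBr mulmxBl !mulmxA EE -(mulmxA Z E E) EE.
  by rewrite opprB addrA addrNK.
have EKE : E *m K *m E = 0 by rewrite EK mulmxBl -mulmxA EE subrr.
have EKK : E *m (K *m K) = K *m K *m E.
  by rewrite mulmxA EK mulmxBl -(mulmxA K E) EK mulmxBr opprB mulmxA addrC subrK.
have [c [c0 cKm cKp]] := exists_sqr_unit (K *m K).
pose Km := c%:M - K; pose Kp := c%:M + K.
have KmKp : Kp *m Km = (c ^+ 2)%:M - K *m K.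
  rewrite /Kp /Km !mulmxDl !mulmxDr !mulmxN !mul_scalar_mx !mul_mx_scalar.
  by rewrite addrA subrK scale_scalar_mx expr2.
have : Kp *m Km \in unitmx by rewrite KmKp.
rewrite unitmx_mul => /andP[Kpu Kmu].
pose G := Kp *m invmx Km.
have Gu : G \in unitmx by rewrite unitmx_mul Kpu unitmx_inv.
have GC i : G^T *m C i *m G = C i by apply: cayley_congr.
have GE : G *m ((c ^+ 2)%:M - K *m K) = (c ^+ 2)%:M + K *m K + (c *+ 2) *: K.
  rewrite -KmKp; have -> : Kp *m Km = Km *m Kp.
    rewrite /Kp /Km !mulmxDl !mulmxDr !mulmxN !mulNmx !mul_scalar_mx !mul_mx_scalar.
    by rewrite addrACA.
  rewrite mulmxA mulmxKV // /Kp !mulmxDl !mulmxDr !mul_scalar_mx !mul_mx_scalar.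
  by rewrite scale_scalar_mx expr2 mulr2n scalerDl [RHS]addrACA [K *m K + _]addrC.
clearbody G.
have EGD : E *m (G *m ((c ^+ 2)%:M - K *m K)) *m E = E *m G *m E *m ((c ^+ 2)%:M - K *m K).
  rewrite -!mulmxA; congr (_ *m (_ *m _)).
  by rewrite mulmxBl mulmxBr EKK scalar_mxC.
have ES : E *m ((c ^+ 2)%:M + K *m K) = ((c ^+ 2)%:M + K *m K) *m E.
  by rewrite mulmxDl mulmxDr EKK scalar_mxC.
have c2 : c *+ 2 != 0 by rewrite mulrn_eq0.
(* Otherwise compressing [GE] by [E] on both sides would give [((c ^+ 2)%:M + K *m K) *m E = 0], and
   the left factor is invertible. *)
have PGP : bsel R e j *m G *m (bsel R e j)^T != 0.
  apply: contraNneq E0 => PGP0.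
  have EGE : E *m G *m E = 0.
    transitivity ((bsel R e j)^T *m (bsel R e j *m G *m (bsel R e j)^T) *m bsel R e j).
      by rewrite Edef !mulmxA.
    by rewrite PGP0 mulmx0 mul0mx.
  move: EGD; rewrite EGE mul0mx GE mulmxDr mulmxDl -scalemxAr -scalemxAl EKE.
  rewrite scaler0 addr0 ES -mulmxA EE => SE.
  by rewrite -(mulKmx cKp E) SE mulmx0.
have PG0 := equivalent_block_monomial Wu (eqW G Gu GC) PGP.
have PGE : bsel R e j *m G = bsel R e j *m G *m E.
  rewrite -[LHS]mulmx1 -(bsel_sum R e) mulmx_sumr (bigD1 j) //= big1 ?addr0 ?Edef // => l lj.
  by rewrite mulmxA PG0 // mul0mx.
have KE0 : bsel R e j *m K *m E = 0 by rewrite -PE -!mulmxA (mulmxA E) EKE mulmx0.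
(* Since [bsel R e j *m G] is unchanged by [E] on the right, so is the j-th block row of [GE]; its
   off-diagonal part [(c *+ 2) *: K] must therefore vanish there. *)
have PK0 : bsel R e j *m K = 0.
  have : bsel R e j *m (G *m ((c ^+ 2)%:M - K *m K)) =
      bsel R e j *m (G *m ((c ^+ 2)%:M - K *m K)) *m E.
    rewrite [LHS]mulmxA PGE -!mulmxA; congr (_ *m (_ *m _)).
    by rewrite mulmxBl mulmxBr EKK scalar_mxC.
  rewrite GE mulmxDr mulmxDl -scalemxAr -scalemxAl KE0 scaler0 addr0.
  rewrite -(mulmxA _ _ E) -ES (mulmxA _ E) PE => /(canRL (addKr _)).
  by rewrite addNr => /eqP; rewrite scaler_eq0 (negPf c2) => /eqP.
have := congr1 (fun X => bsel R e j *m X *m (bsel R e k)^T) Kdef.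
by rewrite PK0 mul0mx mulmxBr mulmxBl mulmxA PE -(mulmxA _ (Z *m E)) -(mulmxA Z) EPk !mulmx0 subr0.
Qed.

(** * Equivalence from permuted projections *)

Lemma rank_bproj (R : realType) t (p : 'I_t -> nat) n
    (e : (\sum_(j < t) p j)%N = n) j :
  \rank (bproj R e j) = p j.
Proof.
have Pfree : row_free (bsel R e j) by apply/row_freeP; exists (bsel R e j)^T; apply: bsel_id.
by rewrite mxrankMfree // mxrank_tr; apply/eqP.
Qed.

(** The inverse appears because row [j] of [perm_mx s] has its 1 in column [s j]; column [k] of
    [perm_mx s^-1] thus has its 1 in row [s k]. *)
Lemma part_mul_perm t (tau : t.-tuple nat) (s : 'S_t) k :
  tnth (part_mul tau (perm_mx s^-1)) k = tnth tau (s k).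
Proof.
rewrite tnth_mktuple mxE (bigD1 (s k)) //= big1 => [|j jk].
  by rewrite !mxE permK eqxx /= addr0 mulr1.
rewrite !mxE; case: eqP => [sjk|_]; last by rewrite mulr0.
by case/eqP: jk; rewrite -sjk permKV.
Qed.

Lemma permuted_bproj_equivalent (R : realType) n t (tau1 tau2 : t.-tuple nat)
    (e1 : (\sum_(j < t) tnth tau1 j)%N = n) (e2 : (\sum_(j < t) tnth tau2 j)%N = n)
    (W1 W2 : 'M[R]_n) (s : 'S_t) :
  W1 \in unitmx -> W2 \in unitmx ->
  (forall l, W2 *m bproj R e2 l *m invmx W2 = W1 *m bproj R e1 (s l) *m invmx W1) ->
  equivalent_solutions tau1 W1 tau2 W2.
Proof.
move=> W1u W2u EW.
(* The block sizes are the ranks of the projections, and conjugation preserves rank. *)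
have tau2E : tau2 = part_mul tau1 (perm_mx s^-1).
  apply: eq_from_tnth => l; rewrite part_mul_perm.
  have := congr1 (@mxrank R n n) (EW l).
  have rank_conj (U X : 'M[R]_n) : U \in unitmx -> \rank (U *m X *m invmx U) = \rank X.
    move=> Uu; rewrite mxrankMfree ?row_free_unit ?unitmx_inv //.
    by rewrite eqmxMfull ?row_full_unit.
  by rewrite !rank_conj // !rank_bproj.
pose V := invmx W1 *m W2.
have Vu : V \in unitmx by rewrite unitmx_mul unitmx_inv W1u.
have VE l : V *m bproj R e2 l = bproj R e1 (s l) *m V.
  have := congr1 (fun X => invmx W1 *m X *m W2) (EW l).
  by rewrite !mulmxA mulVmx // mul1mx mulmxKV.
have WV : W1 *m V = W2 by rewrite mulKVmx.
clearbody V.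
(* [V] has nonzero blocks only at the positions (s l, l). *)
have VP j l : j != s l -> bsel R e1 j *m V *m (bsel R e2 l)^T = 0.
  move=> jsl; have PE0 : bsel R e1 j *m bproj R e1 (s l) = 0.
    by rewrite mulmxA bsel_ortho // mul0mx.
  rewrite -(bproj_bsel R e2 l) -(mulmxA (bsel R e1 j) V) (mulmxA V) VE.
  by rewrite -(mulmxA (bproj R e1 (s l)) V) (mulmxA (bsel R e1 j)) PE0 mul0mx.
subst tau2; pose Q := castmx (e1, e2) (block_perm R tau1 (perm_mx s^-1)).
have QP j l : bsel R e1 j *m Q *m (bsel R e2 l)^T =
    if j == s l then pid_mx (tnth tau1 j) else 0.
  rewrite block_perm_block !mxE -(inj_eq (@perm_inj _ s)) permKV.
  by case: (j == s l).
have QQ : Q^T *m Q = 1%:M.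
  apply: (bsel_inj (e := e2)) => k l.
  rewrite mulmx1.
  transitivity (\sum_j (bsel R e1 j *m Q *m (bsel R e2 k)^T)^T *m
                        (bsel R e1 j *m Q *m (bsel R e2 l)^T)).
    have -> : Q^T *m Q = \sum_j Q^T *m ((bsel R e1 j)^T *m bsel R e1 j) *m Q.
      by rewrite -mulmx_suml -mulmx_sumr bsel_sum mulmx1.
    rewrite mulmx_sumr mulmx_suml.
    by apply: eq_bigr => j _; rewrite !trmx_mul trmxK !mulmxA.
  rewrite (bigD1 (s k)) //= big1 ?addr0 => [|j jsk].
    rewrite !QP eqxx (inj_eq (@perm_inj _ s)); case: eqVneq => [<-|kl].
      rewrite bsel_id tr_pid_mx mul_pid_mx part_mul_perm !minnn.
      by rewrite pid_mx_1.
    by rewrite bsel_ortho // mulmx0.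
  by rewrite QP (negPf jsk) trmx0 mul0mx.
have [QTu Qu] := mulmx1_unit QQ.
(* As [Q] is orthogonal, [V] is [(V *m Q^T) *m Q]; multiplying by [Q^T] moves the blocks of [V] back
   to the diagonal. *)
exists (perm_mx s^-1), (V *m Q^T), e1, e2; split=> //.
- exact: perm_mx_is_perm.
- by rewrite unitmx_mul Vu.
- apply/(block_diagonalP e1) => j k jk.
  rewrite -[V]mulmx1 -(bsel_sum R e2) !(mulmx_sumr, mulmx_suml) big1 // => l _.
  rewrite !mulmxA; have [jsl|jsl] := eqVneq j (s l); last by rewrite VP // !mul0mx.
  rewrite -!mulmxA [_ *m (Q^T *m _)](_ : _ = (bsel R e1 k *m Q *m (bsel R e2 l)^T)^T).
    by rewrite QP -jsl eq_sym (negPf jk) trmx0 !mulmx0.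
  by rewrite !trmx_mul trmxK mulmxA.
by rewrite -/Q !mulmxA WV -mulmxA QQ mulmx1.
Qed.

(** * Systems of idempotents in N(A) *)

(** Idempotence follows from orthogonality and the sum, see [idem_system_id]. The index type is an
    arbitrary finite type so that a system can be enlarged over [option 'I_t]. *)
Definition idem_system (R : realType) (n m : nat) (A : 'I_m -> 'M[R]_n)
    (I : finType) (F : I -> 'M[R]_n) :=
  [/\ forall i j, i != j -> F i *m F j = 0, \sum_i F i = 1%:M,
      forall i, F i != 0 & forall i, F i \in Nspace A].

Lemma idem_system_id (R : realType) (n m : nat) (A : 'I_m -> 'M[R]_n)
    (I : finType) (F : I -> 'M[R]_n) i :
  idem_system A F -> F i *m F i = F i.
Proof.
case=> Fo F1 _ _; rewrite -[RHS]mulmx1 -F1 mulmx_sumr (bigD1 i) //= big1 ?addr0 // => j ji.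
by rewrite Fo // eq_sym.
Qed.

Lemma mul_conj_invmx (R : comUnitRingType) n (W X Y : 'M[R]_n) : W \in unitmx ->
  W *m X *m invmx W *m (W *m Y *m invmx W) = W *m (X *m Y) *m invmx W.
Proof. by move=> Wu; rewrite !mulmxA mulmxKV. Qed.

Lemma solution_idem_system (R : realType) (n m : nat) (A : 'I_m -> 'M[R]_n)
    (t : nat) (tau : t.-tuple nat) (W : 'M[R]_n) (e : (\sum_(j < t) tnth tau j)%N = n) :
  (forall j, 0 < tnth tau j)%N -> JBD_solution A tau W ->
  idem_system A (fun j => W *m bproj R e j *m invmx W).
Proof.
move=> tau_gt0 [Wu Wd]; split=> [i j ij||i|i].
- by rewrite mul_conj_invmx // bproj_ortho // mulmx0 mul0mx.
- by rewrite -mulmx_suml -mulmx_sumr bproj_sum mulmx1 mulmxV.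
- apply: contraNneq (bproj_neq0 R e (tau_gt0 i)) => WE.
  by rewrite -(mulKmx Wu (bproj R e i)) -(mulmxKV Wu (W *m _)) WE mul0mx mulmx0.
apply/(Nspace_congr _ _ Wu)/NspaceP => k; rewrite tr_bproj.
by have /(block_diagonal_commP e) -> := Wd k.
Qed.

(** Take rank factorizations F_l = C_l D_l with D_l C_l = 1; the ranks are the block sizes and the
    C_l are the block columns of [W]. For j != k, C_j^T A C_k = C_j^T A F_k C_k = (F_k C_j)^T A C_k
    = 0. *)
Lemma idem_system_JBD (R : realType) (n m : nat) (A : 'I_m -> 'M[R]_n)
    (s : nat) (F : 'I_s -> 'M[R]_n) :
  idem_system A F ->
  exists2 tau : s.-tuple nat, is_partition n tau & exists W, JBD_solution A tau W.
Proof.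
move=> sysF; have [Fo F1 F0 FN] := sysF.
pose tau := [tuple \rank (F l) | l < s].
have [CD CDP] : exists CD : forall l, 'M[R]_(n, tnth tau l) * 'M[R]_(tnth tau l, n),
    forall l, F l = (CD l).1 *m (CD l).2 /\ (CD l).2 *m (CD l).1 = 1%:M.
  apply: (fin_all_exists (P := fun l CD => F l = CD.1 *m CD.2 /\ CD.2 *m CD.1 = 1%:M)) => l.
  rewrite tnth_mktuple; exists (col_base (F l), row_base (F l)) => /=.
  split; first by rewrite mulmx_base.
  apply: (row_full_inj (col_base_full (F l))); apply: (row_free_inj (row_base_free (F l))).
  have assoc (C : 'M[R]_(n, \rank (F l))) (D : 'M[R]_(\rank (F l), n)) :
    C *m (D *m C) *m D = (C *m D) *m (C *m D) by rewrite !mulmxA.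
  rewrite /= mulmx1 assoc mulmx_base.
  exact: idem_system_id sysF.
pose C l := (CD l).1; pose D l := (CD l).2.
have FE l : F l = C l *m D l by case: (CDP l).
have DC l : D l *m C l = 1%:M by case: (CDP l).
have DC0 k l : k != l -> D k *m C l = 0.
  move=> kl; have := congr1 (fun X => D k *m X *m C l) (Fo _ _ kl).
  by rewrite !FE mulmx0 mul0mx !mulmxA DC mul1mx -mulmxA DC mulmx1.
clearbody C D.
have CDsum : \sum_l C l *m D l = 1%:M by rewrite -F1; apply: eq_bigr => l _; rewrite FE.
(* The stacked [D l] and the juxtaposed [C l] are inverse to each other on both sides, which bounds
   each order by the other. *)
have e : (\sum_(l < s) tnth tau l)%N = n.
  apply/eqP; rewrite eqn_leq; apply/andP; split.
    apply: (@mulmx1_min R _ _ (\mxcol_l D l) (\mxrow_l C l)).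
    rewrite mul_mxcol_mxrow -mxdiagZ; apply/eq_mxblock => k l.
    case: eqP => [<-|/eqP/DC0 //]; by rewrite conform_mx_id.
  by apply: (@mulmx1_min R _ _ (\mxrow_l C l) (\mxcol_l D l)); rewrite mul_mxrow_mxcol.
exists tau; first by split=> // l; rewrite tnth_mktuple lt0n mxrank_eq0.
pose W := \sum_l C l *m bsel R e l.
have WP l : W *m (bsel R e l)^T = C l.
  rewrite mulmx_suml (bigD1 l) //= big1 => [|k kl]; last by rewrite -mulmxA bsel_ortho ?mulmx0.
  by rewrite -mulmxA bsel_id mulmx1 addr0.
exists W; split=> [|i].
  suff /mulmx1_unit[] : W *m (\sum_l (bsel R e l)^T *m D l) = 1%:M by [].
  by rewrite mulmx_sumr -CDsum; apply: eq_bigr => l _; rewrite mulmxA WP.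
apply/(block_diagonalP e) => j k jk.
have -> : bsel R e j *m (W^T *m A i *m W) *m (bsel R e k)^T = (C j)^T *m A i *m C k.
  by rewrite -!WP trmx_mul trmxK !mulmxA.
have -> : C k = F k *m C k by rewrite FE -mulmxA DC mulmx1.
have /NspaceP/(_ i) AF := FN k.
rewrite -mulmxA (mulmxA (A i)) AF -mulmxA mulmxA -trmx_mul FE -mulmxA DC0 1?eq_sym //.
by rewrite mulmx0 trmx0 mul0mx.
Qed.

Lemma idem_system_card (R : realType) (n m : nat) (A : 'I_m -> 'M[R]_n)
    (t : nat) (tau : t.-tuple nat) (W : 'M[R]_n) (I : finType) (F : I -> 'M[R]_n) :
  GJBD_solution A tau W -> idem_system A F -> (#|I| <= t)%N.
Proof.
move=> [_ _ maxt] [Fo F1 F0 FN].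
have [|tau' ptau' JBD] := @idem_system_JBD R n m A #|I| (F \o enum_val).
  split=> [i j ij||i|i] //=; first by rewrite Fo // (inj_eq enum_val_inj).
  rewrite -F1 [RHS](reindex_onto enum_val enum_rank) /= => [|i _]; last by rewrite enum_rankK.
  by apply: eq_bigl => i; rewrite enum_valK eqxx.
exact: maxt JBD.
Qed.

Lemma idem_system_primitive (R : realType) (n m : nat) (A : 'I_m -> 'M[R]_n)
    (t : nat) (tau : t.-tuple nat) (W : 'M[R]_n) (F : 'I_t -> 'M[R]_n) j X :
  GJBD_solution A tau W -> idem_system A F -> X \in Nspace A ->
  X *m X = X -> F j *m X = X -> X *m F j = X -> X = 0 \/ X = F j.
Proof.
move=> sol sysF XN XX FX XF; have [Fo F1 F0 FN] := sysF.
have [->|X0] := eqVneq X 0; [by left|right].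
have [//|XFj] := eqVneq X (F j).
have FXo i : i != j -> F i *m X = 0 by move=> ij; rewrite -FX mulmxA Fo // mul0mx.
have XFo i : i != j -> X *m F i = 0.
  by move=> ij; rewrite -XF -mulmxA Fo ?mulmx0 // eq_sym.
(* Replacing F j by X and F j - X would give t + 1 idempotents. *)
pose F' (o : option 'I_t) := if o is Some i then (if i == j then F j - X else F i) else X.
suff sysF' : idem_system A F'.
  by have := idem_system_card sol sysF'; rewrite card_option card_ord ltnn.
split=> [||[i|]|[i|]] //=.
- move=> [i|] [k|] //= => [ik|_|_].
  + have {}ik : i != k by [].
    case: (eqVneq i j) ik => [->|ij]; case: (eqVneq k j) => [kE|kj] ik //.
    * by rewrite mulmxBl XFo // Fo 1?eq_sym // subr0.
    * by rewrite mulmxBr FXo // Fo // subr0.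
    exact: Fo.
  + by case: eqVneq => [_|ij]; rewrite ?mulmxBl ?FX ?XX ?subrr ?FXo.
  + by case: eqVneq => [_|ij]; rewrite ?mulmxBr ?XF ?XX ?subrr ?XFo.
- rewrite (bigD1 None) //= (reindex_omap Some id) /= => [|[]//].
  under eq_bigl => i do rewrite eqxx.
  rewrite -F1 (bigD1 j) //= eqxx addrA [X + _]addrC subrK [RHS](bigD1 j) //=.
  by congr (_ + _); apply: eq_bigr => i /negPf->.
- by case: (eqVneq i j) => // _; rewrite subr_eq0 eq_sym.
by case: (eqVneq i j) => // _; rewrite memvB.
Qed.

(** Commutation makes F_j F'_l a sub-idempotent of F_j in N(A), hence 0 or F_j by primitivity. Each
    F'_l then dominates some F_j, distinct [l] give distinct [j], and counting makes this a
    permutation. *)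
Lemma idem_system_perm (R : realType) (n m : nat) (A : 'I_m -> 'M[R]_n)
    (t : nat) (tau : t.-tuple nat) (W : 'M[R]_n) (F F' : 'I_t -> 'M[R]_n) :
  GJBD_solution A tau W -> idem_system A F -> idem_system A F' ->
  (forall j Z, Z \in Nspace A -> F j *m Z = Z *m F j) ->
  exists s : 'S_t, forall l, F' l = F (s l).
Proof.
move=> sol sysF sysF' Fc; have [Fo F1 F0 FN] := sysF; have [Fo' F1' F0' FN'] := sysF'.
have FF := fun i => idem_system_id i sysF; have FF' := fun i => idem_system_id i sysF'.
have dich j l : F j *m F' l = 0 \/ F j *m F' l = F j.
  have FcF := Fc j _ (FN' l).
  apply: (idem_system_primitive sol sysF).
  (* Moving [A i] past both factors reverses their order under the transpose; commutation restores
     it. *)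
  - apply/NspaceP => i; have /NspaceP/(_ i) h := FN j; have /NspaceP/(_ i) h' := FN' l.
    by rewrite mulmxA h -mulmxA h' mulmxA -trmx_mul -FcF.
  - by rewrite mulmxA -(mulmxA (F j) (F' l)) -FcF mulmxA FF -mulmxA FF'.
  - by rewrite mulmxA FF.
  by rewrite -mulmxA -FcF mulmxA FF.
have ex l : exists j, F j *m F' l == F j.
  apply/existsP; apply: contraNT (F0' l); rewrite negb_exists => /forallP h.
  rewrite -[F' l]mul1mx -F1 mulmx_suml big1 // => j _.
  by case: (dich j l) => // /eqP; rewrite (negPf (h j)).
pose f l := xchoose (ex l).
have fP l : F (f l) *m F' l = F (f l) by apply/eqP/(xchooseP (ex l)).
have f_inj : injective f.
  move=> k l kl; apply/eqP; apply: contraTT isT => nkl.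
  case/eqP: (F0 (f k)); rewrite -{1}(fP k) {1}kl -(fP l) -mulmxA.
  by rewrite Fo' 1?eq_sym // mulmx0.
exists (perm f_inj) => l; rewrite permE.
rewrite -[F' l]mul1mx -F1 mulmx_suml (bigD1 (f l)) //= fP big1 ?addr0 // => j jl.
(* Every other [j] is [f k] with [k] distinct from [l], and F_j = F_j F'_k is killed by F'_l. *)
have -> : j = f (((perm f_inj)^-1)%g j) by rewrite -permE permKV.
set k := _ j; rewrite -(fP k) -mulmxA Fo' ?mulmx0 //.
apply: contraNneq jl => <-; by rewrite -[f k]permE permKV.
Qed.

(** * Assembling the equivalences *)

Lemma block_diagonal_Nspace_equivalent (R : realType) (n m t : nat)
    (A : 'I_m -> 'M[R]_n) (tau : t.-tuple nat) (W : 'M[R]_n) :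
  GJBD_solution A tau W ->
  (forall Z, Z \in Nspace (fun i => W^T *m A i *m W) -> block_diagonal tau Z) ->
  forall t1 (tau1 : t1.-tuple nat) W1 t2 (tau2 : t2.-tuple nat) W2,
  GJBD_solution A tau1 W1 -> GJBD_solution A tau2 W2 ->
  equivalent_solutions tau1 W1 tau2 W2.
Proof.
move=> sol Nd t1 tau1 W1 t2 tau2 W2 sol1 sol2.
have [[tau_gt0 e] JBD maxt] := sol.
have [[tau1_gt0 e1] JBD1 max1] := sol1.
have [[tau2_gt0 e2] JBD2 max2] := sol2.
have t1t : t1 = t.
  by apply/eqP; rewrite eqn_leq (maxt _ tau1) ?(max1 _ tau); do ?[by exists W | by exists W1].
have t2t : t2 = t.
  by apply/eqP; rewrite eqn_leq (maxt _ tau2) ?(max2 _ tau); do ?[by exists W | by exists W2].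
subst t1 t2.
have sys := solution_idem_system e tau_gt0 JBD.
have sys1 := solution_idem_system e1 tau1_gt0 JBD1.
have sys2 := solution_idem_system e2 tau2_gt0 JBD2.
have Wu : W \in unitmx by case: JBD.
have Nc j Z : Z \in Nspace A ->
    (W *m bproj R e j *m invmx W) *m Z = Z *m (W *m bproj R e j *m invmx W).
  move=> ZN; pose Y := invmx W *m Z *m W.
  have ZE : Z = W *m Y *m invmx W by rewrite /Y !mulmxA mulmxV // mul1mx mulmxK.
  have /Nd/(block_diagonal_commP e) Yc : Y \in Nspace (fun i => W^T *m A i *m W).
    by apply/(Nspace_congr _ _ Wu); rewrite -ZE.
  clearbody Y; by rewrite ZE !mul_conj_invmx // Yc.
have [s1 Fs1] := idem_system_perm sol sys sys1 Nc.
(* The first system is a permutation of the one of [W], so it inherits commutation with N(A) and can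
   be compared directly with the second. *)
have Nc1 j Z : Z \in Nspace A ->
    (W1 *m bproj R e1 j *m invmx W1) *m Z = Z *m (W1 *m bproj R e1 j *m invmx W1).
  by move=> ZN; rewrite Fs1 Nc.
have [s Fs] := idem_system_perm sol sys1 sys2 Nc1.
by case: JBD1 JBD2 => W1u _ [W2u _]; apply: permuted_bproj_equivalent Fs.
Qed.

Theorem theorem2p5 (R : realType) (n m : nat) (A : 'I_m -> 'M[R]_n)
    (t : nat) (tau : t.-tuple nat) (W : 'M[R]_n)
    (B : 'I_m -> forall j : 'I_t, 'M[R]_(tnth tau j))
    (n_gt0 : (0 < n)%N)
    (solW : GJBD_solution A tau W)
    (e : (\sum_(j < t) tnth tau j)%N = n)
    (defB : forall i, W^T *m A i *m W = castmx (e, e) (\mxdiag_(j < t) B i j)) :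
  let all_equivalent :=
    forall (t1 : nat) (tau1 : t1.-tuple nat) (W1 : 'M[R]_n)
           (t2 : nat) (tau2 : t2.-tuple nat) (W2 : 'M[R]_n),
      GJBD_solution A tau1 W1 -> GJBD_solution A tau2 W2 ->
      equivalent_solutions tau1 W1 tau2 W2 in
  let dim_sum :=
    \dim (Nspace A) = (\sum_(j < t) \dim (Nspace (fun i => B i j)))%N in
  let M_nonsingular :=
    forall j k : 'I_t, (j < k)%N ->
      Mjk (fun i => B i j) (fun i => B i k) \in unitmx in
  (all_equivalent <-> dim_sum) /\ (dim_sum <-> M_nonsingular).
Proof.
move=> all_equivalent dim_sum M_nonsingular.
have [[tau_gt0 _] [Wu Wd] _] := solW.
pose C i := castmx (e, e) (\mxdiag_(j < t) B i j).
have NE : Nspace (fun i => W^T *m A i *m W) =i Nspace C.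
  by move=> Z; apply/NspaceP/NspaceP => ZN i; move: (ZN i); rewrite /= defB.
(* Block diagonality of all of N(C) is the pivot to which each of the three statements is
   compared. *)
have dimP : dim_sum <-> (forall Z, Z \in Nspace C -> block_diagonal tau Z).
  exact: dim_Nspace Wu defB.
split; last by rewrite dimP; apply: Nspace_diag_Mjk.
rewrite dimP; split=> [eqW|Nd].
  apply: (equivalent_Nspace_block_diagonal e tau_gt0 Wu) => [i|G Gu GC].
    by rewrite /C -defB.
  (* [W *m G] solves the problem with the same [tau], because congruence by [G] fixes every
     [C i]. *)
  apply: eqW => //; have [tauP _ maxt] := solW; split=> //; split=> [|i].
    by rewrite unitmx_mul Wu.
  have -> : (W *m G)^T *m A i *m (W *m G) = G^T *m (W^T *m A i *m W) *m G.
    by rewrite trmx_mul !mulmxA.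
  by have := Wd i; rewrite defB -/(C i) GC.
move=> t1 tau1 W1 t2 tau2 W2.
by apply: (block_diagonal_Nspace_equivalent solW) => Z; rewrite NE; apply: Nd.
Qed.
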